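(* Let $d\ge2$. For every ordering of the eigenspaces of the cocktail party graph (the edge graph of the cross-polytope $\Diamond_d$) with $\operatorname{span}\{\mathbb{1}\}$ first, every minimal weighted extremal design of the graph is combinatorial.
   Context: $\Diamond_d=\operatorname{conv}\{\pm e_i: i\in[d]\}\subset\mathbb{R}^d$. Its edge graph is the complete multipartite graph $K_{2,\dots,2}$ on the $2d$ vertices $\pm e_i$, in which every two vertices except antipodal pairs $e_i,-e_i$ are adjacent; it is $2(d-1)$-regular. For a connected $\delta$-regular graph $G$ on $n$ vertices with adjacency matrix $A$, eigenvalues and eigenspaces mean those of $\frac1\delta A$. Here the distinct eigenvalues are $1,\ -\frac1{d-1},\ 0$ with multiplicities $1,\ d-1,\ d$, and the eigenspace of $1$ is $\operatorname{span}\{\mathbb{1}\}$. A vertex subset $W$ with real weights $(a_w)_{w\in W}$ averages an eigenspace $\Lambda$ if $\sum_{w\in W}a_w\phi(w)=\frac1n\sum_{v}\phi(v)$ for all $\phi\in\Lambda$. Given an ordering of the eigenspaces, $W$ is a weighted extremal design if there are weights $a_w\in\mathbb{R}$ (arbitrary sign) with which $W$ averages every eigenspace except the last one. It is combinatorial if this holds with $a_w=1/|W|$ for all $w\in W$. Minimal means inclusion-minimal among weighted extremal designs. *)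

(* Defs.v *)
From HB Require Import structures.
From mathcomp Require Import all_boot all_order all_algebra.
From mathcomp Require Import reals.
Set Implicit Arguments.
Unset Strict Implicit.
Unset Printing Implicit Defensive.
Import Order.TTheory GRing.Theory Num.Theory.
Local Open Scope ring_scope.

(* Graphs are relations on a finite vertex type V.  A function phi : V -> R is
   a row vector indexed by the enumeration of V, so phi(v) is
   phi 0 (enum_rank v), and a subspace of functions is the row space of a
   matrix.  Since mathcomp's eigenspaces are left eigenspaces (phi *m M), they
   agree with the usual ones because adjacency matrices are symmetric. *)

Definition adjmx (R : realType) (V : finType) (e : rel V) : 'M[R]_#|V| :=
  \matrix_(i, j) (e (enum_val i) (enum_val j))%:R.

Definition normalized_adjmx (R : realType) (V : finType) (e : rel V)
    (delta : nat) : 'M[R]_#|V| :=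
  delta%:R^-1 *: adjmx R e.

(* An ordering of the eigenspaces is encoded by the list, without repetition,
   of all the eigenvalues: its i-th entry s`_i stands for eigenspace M s`_i. *)
Definition eigenspace_ordering (R : realType) (n : nat) (M : 'M[R]_n)
    (s : seq R) : Prop :=
  uniq s /\ (forall x : R, (x \in s) = eigenvalue M x).

Definition averages (R : realType) (V : finType) (W : {set V}) (a : V -> R)
    (L : 'M[R]_#|V|) : Prop :=
  forall phi : 'rV[R]_#|V|, (phi <= L)%MS ->
    \sum_(w in W) a w * phi 0 (enum_rank w)
    = #|V|%:R^-1 * \sum_(v : V) phi 0 (enum_rank v).

Definition averages_all_but_last (R : realType) (V : finType)
    (M : 'M[R]_#|V|) (s : seq R) (W : {set V}) (a : V -> R) : Prop :=
  forall i : nat, (i < (size s).-1)%N -> averages W a (eigenspace M s`_i).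

Definition weighted_extremal_design (R : realType) (V : finType)
    (M : 'M[R]_#|V|) (s : seq R) (W : {set V}) : Prop :=
  exists a : V -> R, averages_all_but_last M s W a.

Definition combinatorial_extremal_design (R : realType) (V : finType)
    (M : 'M[R]_#|V|) (s : seq R) (W : {set V}) : Prop :=
  averages_all_but_last M s W (fun=> #|W|%:R^-1).

Definition minimal_weighted_extremal_design (R : realType) (V : finType)
    (M : 'M[R]_#|V|) (s : seq R) (W : {set V}) : Prop :=
  weighted_extremal_design M s W /\
  (forall W' : {set V},
     W' \subset W -> weighted_extremal_design M s W' -> W' = W).

(* The vertex (i, b) stands for e_i if b = false and for - e_i if b = true. *)
Definition antipode (d : nat) (v : 'I_d * bool) : 'I_d * bool :=
  (v.1, ~~ v.2).

Definition cocktail_party (d : nat) : rel ('I_d * bool) :=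
  [rel u v | (u != v) && (u != antipode v)].

Definition cocktail_party_mx (R : realType) (d : nat) :
    'M[R]_#|{: 'I_d * bool}| :=
  normalized_adjmx R (@cocktail_party d) (2 * (d - 1)).

Definition cross_polytope_vertex (R : realType) (d : nat) (v : 'I_d * bool) :
    'rV[R]_d :=
  (-1) ^+ v.2 *: delta_mx 0 v.1.

(* For p enumerating the vertices of a polytope: the segment [p u, p v] is an
   edge, i.e. a face cut out by a supporting hyperplane. *)
Definition polytope_edge (R : realType) (d : nat) (V : finType)
    (p : V -> 'rV[R]_d) (u v : V) : Prop :=
  u != v /\ exists (c : 'cV[R]_d) (b : R),
    forall w : V, (p w *m c) 0 0 <= b ?= iff ((w == u) || (w == v)).

Lemma cocktail_partyE (d : nat) (u v : 'I_d * bool) :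
  cocktail_party u v = (u.1 != v.1).
Proof.
case: u v => [i b] [j c]; rewrite /cocktail_party /antipode /= !xpair_eqE.
by case: eqP; case: b; case: c.
Qed.

Lemma cocktail_party_regular (d : nat) (u : 'I_d * bool) :
  #|[pred v | cocktail_party u v]| = (2 * (d - 1))%N.
Proof.
rewrite (eq_card (B := predX (predC1 u.1) predT)); last first.
  by move=> v; rewrite !inE cocktail_partyE andbT eq_sym.
by rewrite cardX cardC1 card_ord card_bool mulnC subn1.
Qed.

Lemma cross_polytope_vertexE (R : realType) (d : nat) (w : 'I_d * bool)
    (c : 'cV[R]_d) :
  (cross_polytope_vertex R w *m c) 0 0 = (-1) ^+ w.2 * c w.1 0.
Proof. by rewrite -scalemxAl mxE -rowE mxE. Qed.

Lemma cocktail_party_cross_polytope (R : realType) (d : nat) (hd : (2 <= d)%N)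
    (u v : 'I_d * bool) :
  cocktail_party u v <-> polytope_edge (@cross_polytope_vertex R d) u v.
Proof.
split=> [|[uv [c [b H]]]].
  rewrite cocktail_partyE => uv; split.
    by apply: contraNneq uv => ->.
  exists (\col_i (if i == u.1 then (-1) ^+ u.2
                  else if i == v.1 then (-1) ^+ v.2 else 0)), 1 => w.
  rewrite cross_polytope_vertexE mxE.
  case: u v w uv => [i b] [j c] [k a] /= ij; rewrite !xpair_eqE.
  have lt11 : (-1 : R) < 1 by rewrite (lt_trans (y := 0)) ?ltrN10 ?ltr01.
  have key (x y : bool) : (-1) ^+ x * (-1) ^+ y <= (1 : R) ?= iff (x == y).
    rewrite -signr_addb; by case: x; case: y; apply/leifP; rewrite /= ?expr1.
  have [-> /=|ki] := eqVneq k i.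
    by rewrite (negPf ij) /= orbF; exact: key.
  have [_ /=|kj] := eqVneq k j; first exact: key.
  by rewrite mulr0; apply/leifP; rewrite /= ltr01.
rewrite cocktail_partyE; apply/eqP => e1.
have e2 : v.2 = ~~ u.2.
  case: u v uv e1 {H} => [i x] [j y] /= + ij; rewrite ij xpair_eqE eqxx /=.
  by case: x; case: y.
have Eu : (cross_polytope_vertex R u *m c) 0 0 = b.
  by apply/eqP; rewrite (H u).2 eqxx.
have Ev : (cross_polytope_vertex R v *m c) 0 0 = b.
  by apply/eqP; rewrite (H v).2 eqxx orbT.
have b0 : b = 0.
  move: Ev Eu; rewrite !cross_polytope_vertexE e2 -e1 signrN mulNr => <- /eqP.
  by rewrite -addr_eq0 -mulr2n mulrn_eq0 /= => /eqP ->; rewrite oppr0.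
have [k ku] : exists k, k != u.1.
  have : (0 < #|predC1 u.1|)%N by rewrite cardC1 card_ord -ltnS prednK ?(ltnW hd).
  by case/card_gt0P => k; rewrite inE => ?; exists k.
have lt (w : 'I_d * bool) : w.1 = k -> (-1) ^+ w.2 * c w.1 0 < 0.
  move=> wk; have /leifP := H w; rewrite cross_polytope_vertexE b0.
  by case: ifP => // /orP[] /eqP E; move: ku; rewrite -wk E ?e1 eqxx.
have := lt (k, false) erefl; have := lt (k, true) erefl => /=.
by rewrite expr0 expr1 mul1r mulN1r oppr_lt0 => h /(lt_trans h); rewrite ltxx.
Qed.

(* Main.v *)
Require Import Defs.
From mathcomp Require Import all_boot all_order all_algebra.
From mathcomp Require Import reals.
From mathcomp Require Import ring lra.
Set Implicit Arguments.
Unset Strict Implicit.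
Unset Printing Implicit Defensive.
Import Order.TTheory GRing.Theory Num.Theory.
Local Open Scope ring_scope.

(** Write [S] for the sum of a function [f] over the vertices.  Every vertex is
    adjacent to all vertices outside its own antipodal pair, so the equation
    of the eigenvalue [x] at [v] reads
      [S - (f v + f (antipode v)) = 2 (d - 1) x f v].
    Solving it shows that the eigenvalues are [1], [0] and [mu = - 1/(d - 1)],
    that the eigenspace of [0] consists of the odd functions
    ([f (antipode v) = - f v]) and that the eigenspace of [mu] consists of the
    even functions of sum [0].  Extend weights on [W] by zero.  They average
    - the constants iff the total weight is [1] ([averages_one]);
    - the odd functions iff antipodal vertices have equal weights
      ([averages_zero]);
    - the even functions of sum [0] iff all antipodal pairs have the same total
      weight ([averages_mu]).

    So when the eigenspace of [0] comes last, a design gives every antipodal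
    pair the weight [1/d] and hence meets every pair; conversely every
    transversal of the pairs is a design with constant weight [1/d].  When the
    eigenspace of [mu] comes last, some vertex of a design has nonzero weight,
    its antipode then has the same weight, and this antipodal pair alone is a
    design with constant weight [1/2].  Either way every design contains a
    design with constant weights.  A minimal design is equal to the one it
    contains, and constant weights of total [1] are [1/|W|]
    ([minimal_design_constant_weights]). *)

(** * Functions on a finite type as row vectors *)

Definition row_of (R : realType) (V : finType) (f : V -> R) : 'rV[R]_#|V| :=
  \row_k f (enum_val k).

Lemma row_ofE (R : realType) (V : finType) (f : V -> R) (v : V) :
  row_of f 0 (enum_rank v) = f v.
Proof. by rewrite mxE enum_rankK. Qed.

Definition extend0 (R : realType) (V : finType) (W : {set V}) (a : V -> R)
    (v : V) : R := if v \in W then a v else 0.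

Lemma sum_extend0 (R : realType) (V : finType) (W : {set V}) (a f : V -> R) :
  \sum_(w in W) a w * f w = \sum_v extend0 W a v * f v.
Proof.
rewrite big_mkcond; apply: eq_bigr => v _; rewrite /extend0.
by case: ifP => //; rewrite mul0r.
Qed.

Lemma averages_row (R : realType) (V : finType) (W : {set V}) (a f : V -> R)
    (L : 'M[R]_#|V|) :
  averages W a L -> (row_of f <= L)%MS ->
  \sum_v extend0 W a v * f v = #|V|%:R^-1 * \sum_v f v.
Proof.
move=> avg /avg; rewrite -sum_extend0; under eq_bigr do rewrite row_ofE.
by move=> ->; under eq_bigr do rewrite row_ofE.
Qed.

Lemma sum_delta (R : realType) (V : finType) (g : V -> R) (i : V) :
  \sum_k g k * (k == i)%:R = g i.
Proof.
rewrite (bigD1 i) //= eqxx mulr1 big1 ?addr0 // => k /negPf ->.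
by rewrite mulr0.
Qed.

(** Minimality identifies [W] with any subset that is already a design, and a
    constant weight of total [1] can only be the inverse of the cardinal. *)
Lemma minimal_design_constant_weights (R : realType) (V : finType)
    (M : 'M[R]_#|V|) (s : seq R) (W W' : {set V}) (c : R) :
  \sum_(w in W') c = 1 ->
  minimal_weighted_extremal_design M s W ->
  W' \subset W -> averages_all_but_last M s W' (fun=> c) ->
  combinatorial_extremal_design M s W.
Proof.
move=> + [_ minW] W'W avg.
have <- : W' = W by apply: minW => //; exists (fun=> c).
rewrite sumr_const -[LHS]mulr_natl => Wc.
have W0 : #|W'|%:R != 0 :> R.
  by apply/eqP => W0; move/eqP: Wc; rewrite W0 mul0r eq_sym oner_eq0.
suff cE : c = #|W'|%:R^-1 by rewrite /combinatorial_extremal_design -cE.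
by apply: (mulfI W0); rewrite Wc mulfV.
Qed.

Lemma averages_one (R : realType) (V : finType) (W : {set V}) (a : V -> R)
    (L : 'M[R]_#|V|) :
  (0 < #|V|)%N -> (L :=: (const_mx 1 : 'rV[R]_#|V|))%MS ->
  averages W a L <-> \sum_(w in W) a w = 1.
Proof.
move=> V0 LE.
have V0R : #|V|%:R != 0 :> R by rewrite pnatr_eq0 -lt0n.
split=> [avg|sum1 phi].
  have := avg (const_mx 1); rewrite LE submx_refl => /(_ isT).
  under eq_bigr do rewrite mxE mulr1.
  by move=> ->; under eq_bigr do rewrite mxE; rewrite sumr_const mulVf.
rewrite LE => /sub_rVP[c ->].
under eq_bigr do rewrite !mxE.
rewrite -mulr_suml sum1 mul1r; under eq_bigr do rewrite !mxE.
by rewrite sumr_const -[X in _ = _ * X]mulr_natl mulKf.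
Qed.

(** * Eigenspaces of the cocktail party graph *)

Section CocktailParty.
Variables (R : realType) (d : nat).
Hypothesis hd : (2 <= d)%N.

Local Notation V := ('I_d * bool)%type.
Local Notation M := (cocktail_party_mx R d).
Local Notation mu := (- (d - 1)%:R^-1 : R).

Implicit Types (f : V -> R) (phi : 'rV[R]_#|{: V}|) (x : R).

Lemma sum_antipodal_pairs f :
  \sum_v f v = \sum_i (f (i, true) + f (i, false)).
Proof.
rewrite (eq_bigr (fun v => f (v.1, v.2))); last by case.
rewrite -(pair_bigA _ (fun i b => f (i, b))) /=; apply: eq_bigr => i _.
by rewrite big_bool.
Qed.

Lemma sum_neighbours f (v : V) :
  \sum_u f u * (cocktail_party u v)%:R =
  \sum_u f u - (f (v.1, true) + f (v.1, false)).
Proof.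
rewrite !sum_antipodal_pairs (bigD1 v.1) //= [in RHS](bigD1 v.1) //=.
rewrite !cocktail_partyE /= eqxx !mulr0 !add0r [RHS]addrAC subrr add0r.
apply: eq_bigr => i iv.
by rewrite !cocktail_partyE /= iv !mulr1.
Qed.

Lemma pred_d_neq0 : (d - 1)%:R != 0 :> R.
Proof. by rewrite pnatr_eq0 subn_eq0 -ltnNge. Qed.

Lemma d_natE : d%:R = (d - 1)%:R + 1 :> R.
Proof. by rewrite natr1 subn1 prednK // (ltnW hd). Qed.

Lemma degree_neq0 : (2 * (d - 1))%:R != 0 :> R.
Proof. by rewrite natrM mulf_neq0 ?pred_d_neq0 // pnatr_eq0. Qed.

Lemma mulmx_cocktail_party phi (v : V) :
  (phi *m M) 0 (enum_rank v) =
  (2 * (d - 1))%:R^-1 * (\sum_u phi 0 (enum_rank u)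
    - (phi 0 (enum_rank (v.1, true)) + phi 0 (enum_rank (v.1, false)))).
Proof.
rewrite -(sum_neighbours (fun u => phi 0 (enum_rank u))).
rewrite -scalemxAr mxE; congr (_ * _); rewrite mxE.
rewrite (reindex_onto (@enum_rank V) enum_val) /=; last by move=> i; rewrite enum_valK.
apply: eq_big => [u|u _]; first by rewrite enum_rankK eqxx.
by rewrite mxE !enum_rankK.
Qed.

Lemma eigenspace_cocktailP phi x :
  reflect (forall v, \sum_u phi 0 (enum_rank u)
             - (phi 0 (enum_rank (v.1, true)) + phi 0 (enum_rank (v.1, false)))
             = (2 * (d - 1))%:R * x * phi 0 (enum_rank v))
          (phi <= eigenspace M x)%MS.
Proof.
apply: (iffP (eigenspaceP (a := x))) => [E v|E].
  have := mulmx_cocktail_party phi v; rewrite E mxE => E'.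
  by rewrite -mulrA E' mulVKf ?degree_neq0.
apply/rowP => k; rewrite -[k]enum_valK mulmx_cocktail_party E mxE.
by rewrite -mulrA mulKf ?degree_neq0.
Qed.

(** The equation of the eigenvalue [0] says that every pair has sum [S]; as
    there are [d > 1] pairs with total [S], this forces [S = 0]. *)
Lemma eigenspace_zeroP phi :
  reflect (forall i, phi 0 (enum_rank (i, true)) = - phi 0 (enum_rank (i, false)))
          (phi <= eigenspace M 0)%MS.
Proof.
apply: (iffP (eigenspace_cocktailP phi 0)) => E; last first.
  move=> v; rewrite (sum_antipodal_pairs (fun u => phi 0 (enum_rank u))).
  rewrite big1 => [|i _]; last by rewrite E addNr.
  by rewrite E addNr mulr0 mul0r subr0.
set S := \sum_u _ in E.
have pairE i : phi 0 (enum_rank (i, true)) + phi 0 (enum_rank (i, false)) = S.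
  by move: (E (i, true)) => /= /eqP; rewrite mulr0 mul0r subr_eq0 => /eqP <-.
have : S = d%:R * S.
  rewrite {1}/S (sum_antipodal_pairs (fun u => phi 0 (enum_rank u))).
  by rewrite (eq_bigr (fun=> S)) // sumr_const card_ord mulr_natl.
move/eqP; rewrite d_natE mulrDl mul1r -subr_eq0 opprD addrCA subrr addr0.
rewrite oppr_eq0 mulf_eq0 (negPf pred_d_neq0) /= => /eqP S0 i.
by apply/eqP; rewrite -addr_eq0 pairE S0.
Qed.

Lemma degree_mu : (2 * (d - 1))%:R * mu = -2.
Proof. by rewrite natrM mulrN -mulrA mulfV ?pred_d_neq0 // mulr1. Qed.

(** Here the equation reads [S = f (antipode v) - f v], whose right-hand side
    changes sign when [v] is replaced by its antipode; so [S = 0]. *)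
Lemma eigenspace_muP phi :
  reflect ((forall i, phi 0 (enum_rank (i, true)) = phi 0 (enum_rank (i, false)))
             /\ \sum_u phi 0 (enum_rank u) = 0)
          (phi <= eigenspace M mu)%MS.
Proof.
apply: (iffP (eigenspace_cocktailP phi mu)) => [E|[E S0] v]; last first.
  by rewrite S0 degree_mu; case: v => i [] /=; rewrite E; ring.
set S := \sum_u _ in E *.
have S0 : S = 0.
  have i : 'I_d by exists 0%N; apply: ltnW.
  by have := E (i, true); have := E (i, false); rewrite degree_mu /=; lra.
by split=> // i; have := E (i, true); rewrite degree_mu S0 /=; lra.
Qed.

Lemma eigenvalue_zero : eigenvalue M 0.
Proof.
have i : 'I_d by exists 0%N; apply: ltnW.
pose phi := row_of (fun v : V => (-1) ^+ v.2 : R).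
apply/eigenvalueP; exists phi.
  by apply/eigenspaceP/eigenspace_zeroP => j; rewrite !row_ofE expr1.
apply/eqP => /rowP/(_ (enum_rank (i, false))); rewrite row_ofE mxE /= => /eqP.
by rewrite oner_eq0.
Qed.

(** The differences of indicators of two antipodal pairs: they span the
    eigenspace of [mu], so they serve as its test functions. *)
Definition pair_diff (i j : 'I_d) (v : V) : R := (v.1 == i)%:R - (v.1 == j)%:R.

Lemma sum_pair_diff i j : \sum_v pair_diff i j v = 0.
Proof.
have sum1 (k : 'I_d) : \sum_l (l == k)%:R = 1 :> R.
  rewrite -[RHS](@sum_delta R 'I_d (fun=> 1) k).
  by apply: eq_bigr => l _; rewrite mul1r.
by rewrite sum_antipodal_pairs /pair_diff /= big_split /= sumrB !sum1 subrr addr0.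
Qed.

Lemma pair_diff_mu i j : (row_of (pair_diff i j) <= eigenspace M mu)%MS.
Proof.
apply/eigenspace_muP; split=> [k|]; first by rewrite !row_ofE.
by under eq_bigr do rewrite row_ofE; exact: sum_pair_diff.
Qed.

Lemma eigenvalue_mu : eigenvalue M mu.
Proof.
pose i := Ordinal (ltnW hd); pose j := Ordinal hd.
apply/eigenvalueP; exists (row_of (pair_diff i j)).
  exact/eigenspaceP/pair_diff_mu.
apply/eqP => /rowP/(_ (enum_rank (i, false))).
rewrite row_ofE mxE /pair_diff /= => /eqP.
by rewrite subr0 oner_eq0.
Qed.

(** The graph is regular, so the constants belong to the eigenvalue [1]. *)
Lemma eigenvalue_one x :
  (eigenspace M x :=: (const_mx 1 : 'rV[R]_#|{: V}|))%MS -> x = 1.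
Proof.
move=> E; have i : 'I_d by exists 0%N; apply: ltnW.
have /eigenspaceP/rowP/(_ (enum_rank (i, true))) :
    ((const_mx 1 : 'rV[R]_#|{: V}|) <= eigenspace M x)%MS by rewrite E.
rewrite mulmx_cocktail_party !mxE mulr1 => <-.
under eq_bigr do rewrite mxE.
rewrite sumr_const card_prod card_ord card_bool (natrM _ d 2) d_natE.
rewrite (_ : _ - _ = (2 * (d - 1))%:R) ?mulVf ?degree_neq0 //.
by rewrite natrM; ring.
Qed.

(** If [x != 0] the eigenfunctions are even, and summing the eigenvalue
    equation over the pairs gives [(d - 1) S = (d - 1) x S].  So [S = 0] unless
    [x = 1], and then the equation itself forces [x = mu]. *)
Lemma eigenvalues_cocktail x : eigenvalue M x -> x \in [:: 1; 0; mu].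
Proof.
case/eigenvalueP=> phi /eigenspaceP/eigenspace_cocktailP E phi0.
rewrite !inE; have [//|x1 /=] := eqVneq x 1; have [//|x0 /=] := eqVneq x 0.
set S := \sum_u _ in E; pose D : R := (d - 1)%:R.
have D0 : D != 0 := pred_d_neq0.
have deg : (2 * (d - 1))%:R = 2 * D :> R by rewrite natrM.
have even j : phi 0 (enum_rank (j, true)) = phi 0 (enum_rank (j, false)).
  apply: (mulfI (mulf_neq0 degree_neq0 x0)).
  by rewrite -(E (j, true)) -(E (j, false)).
have pairE j : S - (phi 0 (enum_rank (j, true)) + phi 0 (enum_rank (j, false)))
    = D * x * (phi 0 (enum_rank (j, true)) + phi 0 (enum_rank (j, false))).
  by have := E (j, true); rewrite deg -even /= => ->; ring.
have S0 : S = 0.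
  have := eq_bigr (P := xpredT) (r := index_enum 'I_d) (op := +%R) (idx := 0)
    _ (fun j _ => pairE j).
  rewrite sumrB -mulr_sumr sumr_const card_ord -mulr_natl.
  rewrite -(sum_antipodal_pairs (fun u => phi 0 (enum_rank u))) -/S d_natE -/D.
  move=> SE; have /eqP : (D * (x - 1)) * S = 0 by move: SE; lra.
  by rewrite !mulf_eq0 (negPf D0) subr_eq0 (negPf x1) /= => /eqP.
have [k phik] : exists k, phi 0 k != 0 by apply/rV0Pn.
have /eqP : (1 + D * x) * phi 0 k = 0.
  have := pairE (enum_val k).1; have := even (enum_val k).1.
  rewrite S0 -[in phi 0 k](enum_valK k).
  by case: (enum_val k) => j [] /= -> h; move: h; lra.
rewrite mulf_eq0 (negPf phik) orbF => /eqP Dx.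
by apply/eqP/(mulfI D0); rewrite mulrN mulfV //; move: Dx; lra.
Qed.

(** The average of an odd function is [0].  The odd function supported on a
    single antipodal pair compares the two weights of that pair. *)
Lemma averages_zero (W : {set V}) (a : V -> R) :
  averages W a (eigenspace M 0) <->
  forall i, extend0 W a (i, true) = extend0 W a (i, false).
Proof.
split=> [avg i|aE phi].
  pose f (v : V) : R := (v.1 == i)%:R * (-1) ^+ v.2.
  have /(averages_row avg) : (row_of f <= eigenspace M 0)%MS.
    by apply/eigenspace_zeroP => j; rewrite !row_ofE /f /= expr1 expr0; ring.
  rewrite !sum_antipodal_pairs /f /= expr1 expr0 [X in _ * X]big1; last first.
    by move=> j _; ring.
  rewrite (eq_bigr (fun k => (extend0 W a (k, false) - extend0 W a (k, true))
    * (k == i)%:R)); last by move=> k _; ring.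
  by rewrite sum_delta; lra.
move=> /eigenspace_zeroP phiE.
rewrite (sum_extend0 W a (fun v => phi 0 (enum_rank v))).
rewrite !sum_antipodal_pairs !big1 ?mulr0 // => i _.
  by rewrite phiE addNr.
by rewrite aE phiE mulrN addNr.
Qed.

(** For an even function the weighted sum only sees the total weights of the
    pairs, and a common value of these factors out of a sum that vanishes.
    Conversely [pair_diff i j] compares the pairs [i] and [j]. *)
Lemma averages_mu (W : {set V}) (a : V -> R) :
  averages W a (eigenspace M mu) <->
  forall i j, extend0 W a (i, true) + extend0 W a (i, false) =
              extend0 W a (j, true) + extend0 W a (j, false).
Proof.
split=> [avg i j|aE phi].
  have := averages_row avg (pair_diff_mu i j).
  rewrite sum_pair_diff mulr0 sum_antipodal_pairs /pair_diff /=.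
  pose P k := extend0 W a (k, true) + extend0 W a (k, false).
  rewrite (eq_bigr (fun k => P k * (k == i)%:R - P k * (k == j)%:R)); last first.
    by move=> k _; rewrite /P; ring.
  by rewrite sumrB !sum_delta => /eqP; rewrite subr_eq0 => /eqP.
move=> /eigenspace_muP[even S0].
rewrite (sum_extend0 W a (fun v => phi 0 (enum_rank v))) S0 mulr0.
have i : 'I_d by exists 0%N; apply: ltnW.
have halfS0 : \sum_j phi 0 (enum_rank (j, false)) = 0.
  move: S0; rewrite (sum_antipodal_pairs (fun u => phi 0 (enum_rank u))).
  by rewrite big_split /= (eq_bigr _ (fun j _ => even j)); lra.
rewrite sum_antipodal_pairs.
under eq_bigr => j _ do rewrite even -mulrDl (aE j i).
by rewrite -mulr_sumr halfS0 mulr0.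
Qed.

Lemma total_weight (W : {set V}) (a : V -> R) :
  \sum_(w in W) a w = \sum_i (extend0 W a (i, true) + extend0 W a (i, false)).
Proof.
rewrite -sum_antipodal_pairs; have := sum_extend0 W a (fun=> 1).
by under eq_bigr do rewrite mulr1; under [in RHS]eq_bigr do rewrite mulr1.
Qed.

(** * Constant-weight designs inside designs *)

(** Some vertex of a design has nonzero weight, and so has its antipode. *)
Lemma antipodal_subdesign (W : {set V}) (a : V -> R) :
  \sum_(w in W) a w = 1 -> averages W a (eigenspace M 0) ->
  exists2 W' : {set V}, W' \subset W &
    \sum_(w in W') 2^-1 = 1 :> R /\
    averages W' (fun=> 2^-1) (eigenspace M 0).
Proof.
rewrite total_weight => sum1 /averages_zero aE.
have [i ai] : exists i, extend0 W a (i, true) != 0.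
  apply/existsP; apply: contraPT sum1 => /existsPn a0.
  rewrite big1 => [/esym/eqP|i _]; first by rewrite oner_eq0.
  by rewrite -aE (eqP (negbNE (a0 i))) addr0.
have supp b : (i, b) \in W.
  by move: b ai (aE i) => []; rewrite /extend0; case: ifP => //; rewrite ?eqxx //;
    case: ifP => // _ _ + E; rewrite E eqxx.
exists [set (i, true); (i, false)].
  by apply/subsetP => v; rewrite !inE => /orP[] /eqP ->.
split; first by rewrite sumr_const cards2 xpair_eqE eqxx /= -[LHS]mulr_natl mulfV ?pnatr_eq0.
by apply/averages_zero => j; rewrite /extend0 !inE !xpair_eqE /= !andbT !andbF orbF.
Qed.

(** The pairs have equal total weights, which are nonzero because they add up
    to [1]; so the design meets every pair. *)
Lemma transversal_subdesign (W : {set V}) (a : V -> R) :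
  \sum_(w in W) a w = 1 -> averages W a (eigenspace M mu) ->
  exists2 W' : {set V}, W' \subset W &
    \sum_(w in W') d%:R^-1 = 1 :> R /\
    averages W' (fun=> d%:R^-1) (eigenspace M mu).
Proof.
rewrite total_weight => sum1 /averages_mu aE.
have meets i : ((i, true) \in W) || ((i, false) \in W).
  apply: contraPT sum1; rewrite negb_or => /andP[/negPf it /negPf jf].
  have Pi0 : extend0 W a (i, true) + extend0 W a (i, false) = 0.
    by rewrite /extend0 it jf addr0.
  rewrite big1 => [/esym/eqP|j _]; first by rewrite oner_eq0.
  by rewrite (aE j i).
(* W' takes (i, true) from the pair i when W contains it, else (i, false). *)
pose W' := [set v : V | v.2 == ((v.1, true) \in W)].
have pairE i : extend0 W' (fun=> d%:R^-1) (i, true)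
    + extend0 W' (fun=> d%:R^-1) (i, false) = d%:R^-1 :> R.
  by rewrite /extend0 !inE /=; case: (_ \in W); rewrite /= ?addr0 ?add0r.
exists W'.
  apply/subsetP => -[i b]; rewrite inE /= => /eqP ->.
  by have := meets i; case it: ((i, true) \in W).
split; last by apply/averages_mu => i j; rewrite !pairE.
rewrite total_weight; under eq_bigr do rewrite pairE.
by rewrite sumr_const card_ord -[LHS]mulr_natl mulfV // pnatr_eq0 -lt0n ltnW.
Qed.

(** * Orderings of the eigenspaces *)

(** The constants come first, so the two other eigenvalues are listed in one
    of two orders. *)
Lemma cocktail_orderings (s : seq R) :
  eigenspace_ordering M s -> head 0 s = 1 ->
  s = [:: 1; 0; mu] \/ s = [:: 1; mu; 0].
Proof.
case=> uniq_s sE.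
have zs : 0 \in s by rewrite sE eigenvalue_zero.
have ms : mu \in s by rewrite sE eigenvalue_mu.
have mu0 : mu != 0 by rewrite oppr_eq0 invr_eq0 pred_d_neq0.
have mu1 : mu != 1.
  have : mu <= 0 by rewrite oppr_le0 invr_ge0 ler0n.
  by move=> mu_le0; apply: contraTneq mu_le0 => ->; rewrite -ltNge ltr01.
case: s zs ms sE uniq_s => // x t zs ms sE uniq_s /= x1.
move: zs ms sE uniq_s; rewrite x1 !inE eq_sym oner_eq0 (negPf mu1) /= => zt mt.
move=> sE /andP[onet uniq_t].
have : perm_eq t [:: 0; mu].
  apply: uniq_perm => //=; first by rewrite inE eq_sym mu0.
  move=> y; apply/idP/idP => [yt|]; last by rewrite !inE => /orP[] /eqP ->.
  have : y \in [:: 1; 0; mu] by apply: eigenvalues_cocktail; rewrite -sE inE yt orbT.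
  by rewrite inE => /orP[/eqP y1|//]; rewrite -y1 yt in onet.
move=> t2; have := perm_size t2.
case: t {zt mt sE onet} uniq_t t2 => [|y [|z [|]]] //= + t2 _.
rewrite inE andbT => yz; have := perm_mem t2 y; have := perm_mem t2 z.
rewrite !inE !eqxx orbT /= => /esym/orP[]/eqP zE /esym/orP[]/eqP yE.
- by rewrite zE yE eqxx in yz.
- by right; rewrite zE yE.
- by left; rewrite zE yE.
- by rewrite zE yE eqxx in yz.
Qed.

Lemma averages_all_but_last3 (W : {set V}) (a : V -> R) (x y z : R) :
  averages_all_but_last M [:: x; y; z] W a <->
  averages W a (eigenspace M x) /\ averages W a (eigenspace M y).
Proof.
split=> [avg|[avgx avgy] [|[|]] //].
by split; [exact: (avg 0%N) | exact: (avg 1%N)].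
Qed.

End CocktailParty.

Theorem theorem4p3 (R : realType) (d : nat) (hd : (2 <= d)%N)
    (s : seq R)
    (hs : eigenspace_ordering (cocktail_party_mx R d) s)
    (hs1 : (eigenspace (cocktail_party_mx R d) (head 0 s)
              :=: (const_mx 1 : 'rV[R]_#|{: 'I_d * bool}|))%MS)
    (W : {set 'I_d * bool}) :
  minimal_weighted_extremal_design (cocktail_party_mx R d) s W ->
  combinatorial_extremal_design (cocktail_party_mx R d) s W.
Proof.
have s1 := eigenvalue_one hd hs1; rewrite s1 in hs1.
have V0 : (0 < #|{: 'I_d * bool}|)%N.
  by rewrite card_prod card_ord card_bool muln_gt0 (ltnW hd).
have one U a := averages_one U a V0 hs1.
have [sE|sE] := cocktail_orderings hd hs s1; rewrite {s s1 hs}sE => minW.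
  have [a /averages_all_but_last3[/one sum1 avg]] := minW.1.
  have [W' W'W [sum1' avg']] := antipodal_subdesign hd sum1 avg.
  apply: (minimal_design_constant_weights sum1' minW W'W).
  by apply/averages_all_but_last3; split=> //; apply/one.
have [a /averages_all_but_last3[/one sum1 avg]] := minW.1.
have [W' W'W [sum1' avg']] := transversal_subdesign hd sum1 avg.
apply: (minimal_design_constant_weights sum1' minW W'W).
by apply/averages_all_but_last3; split=> //; apply/one.
Qed.
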